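(* For all integers $N\ge 10$, \[ Y_0(N)\le\min\{\beta(N),\beta'(N)\}. \] Moreover, for all $N\ge 300$ the stronger bound $Y_0(N)\le\tfrac16\sigma^1(N)-p_{N+1}$ holds.
   Context: $p_n$ denotes the $n$-th prime, $P_N=p_1p_2\cdots p_N$, and $q=p_{N+1}$. Put $D_1(N)=\{P_N/p_i:1\le i\le N\}$ and $D_2(N)=\{P_N/(p_ip_j):1\le i<j\le N\}$, and for $r\in\{1,2\}$ let $\sigma^r(N)=\sum_{x\in D_r(N)}x$. Put $a_N=\lceil\tfrac16\sigma^2(N)\rceil$ and $b_N=\lfloor\tfrac56\sigma^2(N)\rfloor$. Define \[ \beta(N)=a_{N+1}-q\,a_N,\qquad \beta'(N)=\sigma^1(N)-b_{N+1}+q\,b_N, \] and \[ Y_0(N)=\max_{r\in\mathbb{Z}/q\mathbb{Z}}\ \min\Bigl\{\sum_{x\in S}x:\ S\subseteq D_1(N),\ \sum_{x\in S}x\equiv r\pmod q\Bigr\} \] (the inner minimum being $+\infty$ if no such $S$ exists; the assertion includes that it is finite for $N\ge 10$). *)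

(* Defs.v *)
From mathcomp Require Import all_boot all_order all_algebra finmap.
From mathcomp Require Import constructive_ereal.
Set Implicit Arguments. Unset Strict Implicit. Unset Printing Implicit Defensive.
Import Order.TTheory GRing.Theory Num.Theory.
Local Open Scope ring_scope.
Local Open Scope fset_scope.

Lemma ex_prime_above m : exists p, (m < p)%N && prime p.
Proof. by have [p mp pp] := prime_above m; exists p; rewrite mp. Qed.

Definition next_prime (m : nat) : nat := ex_minn (ex_prime_above m).

(* 1-indexed: p 1 = 2, p 2 = 3, p 3 = 5; the junk value p 0 = 1 is never
   used as a prime. *)
Definition p (n : nat) : nat := iter n next_prime 1%N.

Definition P (N : nat) : nat := (\prod_(1 <= i < N.+1) p i)%N.

(* The divisions in D1 and D2 are exact. *)
Definition D1 (N : nat) : {fset nat} :=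
  [fset x in [seq (P N %/ p i)%N | i <- index_iota 1 N.+1]].

Definition D2 (N : nat) : {fset nat} :=
  [fset x in [seq (P N %/ (p i * p j))%N
             | i <- index_iota 1 N.+1, j <- index_iota i.+1 N.+1]].

Definition sigma1 (N : nat) : nat := (\sum_(x <- D1 N) x)%N.
Definition sigma2 (N : nat) : nat := (\sum_(x <- D2 N) x)%N.

Definition a (N : nat) : int := Num.ceil (1 / 6 * (sigma2 N)%:R : rat).
Definition b (N : nat) : int := Num.floor (5 / 6 * (sigma2 N)%:R : rat).

Definition beta (N : nat) : int := a N.+1 - (p N.+1)%:Z * a N.

Definition beta' (N : nat) : int :=
  (sigma1 N)%:Z - b N.+1 + (p N.+1)%:Z * b N.

(* The empty minimum is +oo. *)
Definition Y0 (N : nat) : \bar rat :=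
  \big[maxe/-oo%E]_(r : 'Z_(p N.+1))
    \big[mine/+oo%E]_(S <- fpowerset (D1 N)
                      | (\sum_(x <- S) x)%N%:R == r :> 'Z_(p N.+1))
      ((\sum_(x <- S) x)%N%:R)%:E.

(* Main.v *)
From Stdlib Require Import BinNums BinNat Nnat MSetPositive.
Require Import Defs.
From mathcomp Require Import all_boot all_order all_algebra finmap.
From mathcomp Require Import constructive_ereal.
From mathcomp Require Import zify lra.
Set Implicit Arguments. Unset Strict Implicit. Unset Printing Implicit Defensive.
Import Order.TTheory GRing.Theory Num.Theory.

(* Since sigma2(N+1) = q sigma2(N) + sigma1(N), both beta(N) and beta'(N) are at
   least sigma1(N)/6 - q, so it is enough to bound Y0(N) by sigma1(N)/6 - q, and
   this holds for every N >= 10.  As P_N/p is P_N times the inverse of p modulo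
   q, one needs a set T of primes below q with sum of 1/p over T less than about
   1/6 of the sum over all primes below q, and such that the subset sums of the
   inverses of T cover Z/q.
   - For large q take for T about 4 sqrt q primes that are not too small.  If A
     has at most q/2 elements, Cauchy-Davenport applied to the symmetric set
     B u -B u {0} gives b in B such that A u (A + b) is noticeably larger than A;
     iterating over half of T gives more than q/2 subset sums, and two sets with
     more than q/2 elements have sumset Z/q.  Chebyshev's lower bound for the
     number of primes provides enough primes when q >= 182^2; from 90^2 to 182^2
     the primes are counted by computation.
   - For 79 <= q < 90^2 one finds by computation a prime t and primes d such that
     t/d is c or -c modulo q, where each c is at most one more than the sum of
     the preceding ones; the subset sums then fill an interval of length >= q - 1.
   - For 31 <= q < 79 the subset sums are enumerated. *)

(** * Growth of subset sums modulo a prime *)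

Section Sumsets.
Local Open Scope ring_scope.
Variable V : finZmodType.
Implicit Types (A B C : {set V}) (a b c x : V).

Definition translate c A : {set V} := [set x + c | x in A].
Definition addset A B : {set V} := [set x + y | x in A, y in B].

Lemma mem_translate c A x : (x \in translate c A) = (x - c \in A).
Proof.
apply/imsetP/idP => [[y yA ->]|xA]; first by rewrite addrK.
by exists (x - c) => //; rewrite subrK.
Qed.

Lemma card_translate c A : #|translate c A| = #|A|.
Proof. by rewrite card_imset //; exact: addIr. Qed.

Lemma mem_addset A B a b : a \in A -> b \in B -> a + b \in addset A B.
Proof. by move=> aA bB; apply/imset2P; exists a b. Qed.

Lemma card_addset_ge A B : B != set0 -> (#|A| <= #|addset A B|)%N.
Proof.
case/set0Pn => b bB; rewrite -(card_translate b); apply/subset_leq_card.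
by apply/subsetP => x /imsetP[a aA ->]; exact: mem_addset.
Qed.

(** The growth of [A] when it is enlarged by its translate by [c]. As a function of [c] it is
    subadditive and even, which makes averaging over a sumset possible. *)
Definition gain A c : nat := #|translate c A :\: A|.

Lemma gain0 A : gain A 0 = 0%N.
Proof.
apply/eqP; rewrite cards_eq0; apply/eqP/setP => x.
by rewrite !inE mem_translate subr0 andNb.
Qed.

Lemma gainE A c : (gain A c + #|translate c A :&: A| = #|A|)%N.
Proof. by rewrite /gain addnC cardsID card_translate. Qed.

(** A point of [A + b + c] outside [A] either misses [A + c], hence is a [c]-translate of a point
    gained by [b], or is gained by [c]. *)
Lemma gainD A b c : (gain A (b + c)%R <= gain A b + gain A c)%N.
Proof.
apply: leq_trans (_ : #|(translate (b + c)%R A :\: translate c A)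
                        :|: (translate c A :\: A)| <= _)%N.
  apply/subset_leq_card/subsetP => x; rewrite !inE !mem_translate.
  by move=> /andP[-> ->]; case: (x - c \in A).
apply: (leq_trans (leq_card_setU _ _)); rewrite leq_add2r /gain.
rewrite -(card_translate c (translate b A :\: A)); apply/subset_leq_card/subsetP => x.
by rewrite !inE !mem_translate !inE !mem_translate [b + c]addrC opprD addrA.
Qed.

Lemma gainN A c : gain A (- c) = gain A c.
Proof.
apply/eqP; rewrite -(eqn_add2r #|translate c A :&: A|) gainE.
rewrite -(gainE A (- c)) eqn_add2l; apply/eqP.
rewrite -(card_translate (- c) (translate c A :&: A)); apply: eq_card => x.
by rewrite mem_translate !inE !mem_translate opprK addrK andbC.
Qed.

(** Each ordered pair of elements of [A] determines a single difference [c], so the overlaps of [A]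
    with its translates add up to at most [#|A| * #|A|]. *)
Lemma sum_gain A C : (#|C| * #|A| <= \sum_(c in C) gain A c + #|A| * #|A|)%N.
Proof.
rewrite -sum_nat_const.
under eq_bigr => c _ do rewrite -(gainE A c).
rewrite big_split /= leq_add2l.
apply: leq_trans (_ : \sum_c #|translate c A :&: A| <= _)%N.
  by rewrite [leqRHS](bigID (mem C)) /= leq_addr.
under eq_bigr => c _ do rewrite -sum1_card big_mkcond /=.
rewrite exchange_big /= -sum_nat_const [leqRHS]big_mkcond /=.
apply: leq_sum => a _; case: ifP => aA; last first.
  by rewrite big1 // => c _; rewrite inE aA andbF.
under eq_bigr => c _ do rewrite inE aA andbT mem_translate.
rewrite -big_mkcond sum1_card /= -(card_imset (mem A) (@oppr_inj V)).
rewrite -(card_translate a [set - x | x in A]); apply/subset_leq_card/subsetP => c.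
move=> cA; rewrite mem_translate; apply/imsetP; exists (a - c); first exact: cA.
by rewrite opprB.
Qed.

End Sumsets.

(** * Cauchy-Davenport and its use for subset sums *)

Section CauchyDavenport.
Local Open Scope ring_scope.
Variable p : nat.
Hypothesis p_pr : prime p.
Implicit Types (A B : {set 'F_p}).

Lemma translate_stable_full A (d : 'F_p) : A != set0 -> d != 0 ->
  (forall a, a \in A -> a + d \in A) -> A = [set: 'F_p].
Proof.
case/set0Pn => a aA d0 dA; apply/setP => x; rewrite inE.
have aux n : a + d *+ n \in A.
  by elim: n => [|n IH]; [rewrite addr0 | rewrite mulrSr addrA dA].
have := aux (val ((x - a) / d)); rewrite -mulr_natl natr_Zp divfK //.
by rewrite addrC subrK.
Qed.

(* Dyson's e-transform. *)
Lemma cauchy_davenport A B : A != set0 -> B != set0 ->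
  (minn p (#|A| + #|B|).-1 <= #|addset A B|)%N.
Proof.
have [n] := ubnP #|B|; elim: n A B => // n IH A B Bn A0 B0.
(* If no transform can shrink [B], then [A] is stable under all differences of [B]: either [B] is a
   singleton or [A] is everything. *)
have [/forall_inP stA|] :=
  boolP [forall a in A, forall b in B, forall c in B, a + (c - b) \in A].
  apply: leq_trans (card_addset_ge A B0).
  have [B1|/card_gt1P[b [c [bB cB bc]]]] := leqP #|B| 1%N.
    have : (#|B| > 0)%N by rewrite card_gt0.
    by case: #|B| B1 => [|[|//]] // _ _; rewrite addn1 geq_minr.
  rewrite (@translate_stable_full A (c - b)) ?cardsT ?card_Fp ?geq_minl //.
    by rewrite subr_eq0 eq_sym.
  by move=> a /stA /forall_inP/(_ _ bB)/forall_inP/(_ _ cB).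
rewrite negb_forall_in => /exists_inP[a aA].
rewrite negb_forall_in => /exists_inP[b bB].
rewrite negb_forall_in => /exists_inP[c cB cA].
(* With this [e], [B'] keeps [b] and loses [c], so it is nonempty and strictly smaller; the total
   size is preserved and [A' + B'] lies inside [A + B]. *)
pose e := a - b; pose B' := [set y in B | y + e \in A]; pose A' := A :|: translate e B.
have bB' : b \in B' by rewrite inE bB /e addrC subrK.
have cB' : c \notin B' by rewrite inE cB /e addrCA.
have ltB' : (#|B'| < #|B|)%N.
  apply: proper_card; apply/properP; split; last by exists c.
  by apply/subsetP => y; rewrite inE => /andP[].
have := IH A' B'; move/(_ (leq_trans ltB' Bn)) => {}IH.
have eqAB : (#|A'| + #|B'| = #|A| + #|B|)%N.
  rewrite -(card_translate e B) -(cardsUI A (translate e B)); congr (_ + _)%N.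
  rewrite -(card_translate e B'); apply: eq_card => y.
  by rewrite inE !mem_translate !inE subrK andbC.
rewrite -eqAB; apply: leq_trans (IH _ _) _.
- by apply/set0Pn; exists a; rewrite inE aA.
- by apply/set0Pn; exists b.
apply/subset_leq_card/subsetP => z /imset2P[x y].
rewrite !inE mem_translate => /orP[xA|xB] /andP[yB yA] ->; first exact: mem_addset.
by rewrite -(subrK e x) -addrA [e + y]addrC addrC mem_addset.
Qed.

Definition nfold_sum k A : {set 'F_p} := iter k (addset A) [set 0].

Lemma card_nfold_sum k A : 0 \in A ->
  (minn p (k * #|A|.-1).+1 <= #|nfold_sum k A|)%N.
Proof.
move=> A0; elim: k => [|k IH]; first by rewrite cards1 geq_minr.
have AN : A != set0 by apply/set0Pn; exists 0.
have N0 : nfold_sum k A != set0.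
  rewrite -card_gt0; apply: leq_trans IH.
  by rewrite leq_min prime_gt0.
have := cauchy_davenport AN N0; move: IH; rewrite mulSn [nfold_sum k.+1 A]iterS -/(nfold_sum k A).
have : (#|A| > 0)%N by rewrite card_gt0.
move: #|A| #|nfold_sum _ _| #|addset _ _| => u v w; lia.
Qed.

Lemma gain_nfold_sum k A (C : {set 'F_p}) M : (forall c, c \in C -> (gain A c <= M)%N) ->
  forall c, c \in nfold_sum k C -> (gain A c <= k * M)%N.
Proof.
move=> CM; elim: k => [|k IH] c; first by rewrite inE => /eqP->; rewrite gain0.
case/imset2P => x y /CM xM /IH yM ->; rewrite mulSn.
exact: leq_trans (gainD _ _ _) (leq_add xM yM).
Qed.

(* The symmetric set C = B u -B u {0} has 2|B|+1 elements, so by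
   Cauchy-Davenport its k-fold sumset has at least 2|A| elements; averaging the
   subadditive function [gain A] over that sumset yields the bound. *)
Lemma exists_gain k A B :
  [disjoint B & [set - b | b in B]] -> (0 < #|A|)%N -> (#|A| <= k * #|B|)%N ->
  (2 * #|A| <= p)%N -> exists2 b, b \in B & (#|A| <= 2 * k * gain A b)%N.
Proof.
move=> BN A0 AkB Ap; apply/exists_inP; apply: contraLR AkB.
rewrite negb_exists_in => /forall_inP small; rewrite -ltnNge.
have [->|] := posnP k; first by rewrite mul0n.
move=> k0; rewrite ltnNge; apply/negP => AkB.
pose C := 0 |: (B :|: [set - b | b in B]).
have B0 : 0 \notin B.
  apply/negP => B0; have /pred0P/(_ 0) := BN; rewrite /= B0 /=.
  by move/negP; apply; apply/imsetP; exists 0; rewrite ?oppr0.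
have cardC : #|C| = (2 * #|B|).+1.
  rewrite cardsU1 !inE (negbTE B0) /=.
  have -> : 0 \notin [set - b | b in B].
    by apply/imsetP => -[b bB /esym/eqP]; rewrite oppr_eq0 => /eqP b0; move: B0; rewrite -b0 bB.
  rewrite cardsU; move: BN; rewrite -setI_eq0 => /eqP->.
  by rewrite cards0 subn0 card_imset ?mul2n ?addnn //; exact: oppr_inj.
pose M := (#|A|.-1 %/ (2 * k))%N.
have CM c : c \in C -> (gain A c <= M)%N.
  have smallM b : b \in B -> (gain A b <= M)%N.
    move=> /small; rewrite -ltnNge => h; rewrite /M leq_divRL ?muln_gt0 //.
    by rewrite mulnC; move: h A0; lia.
  rewrite !inE => /or3P[/eqP->|/smallM //|/imsetP[b /smallM bM ->]].
    by rewrite gain0.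
  by rewrite gainN.
have := card_nfold_sum k (setU11 0 _ : 0 \in C); rewrite cardC /=.
set D := nfold_sum k C => cardD.
have D2A : (2 * #|A| <= #|D|)%N.
  apply: leq_trans cardD; rewrite leq_min Ap mulnCA.
  by move: AkB; move: (k * #|B|)%N => u; lia.
have /leq_trans : (\sum_(c in D) gain A c <= \sum_(c in D) k * M)%N.
  by apply: leq_sum => c; exact: gain_nfold_sum.
move=> /(_ _ (leqnn _)); rewrite sum_nat_const => sD.
have kM : (2 * (k * M) < #|A|)%N.
  by rewrite mulnA mulnC (leq_ltn_trans (leq_divM _ _)) // prednK.
(* [sum_gain] gives [#|D| #|A| <= #|D| k M + #|A|^2], which contradicts [2 k M < #|A|] and
   [2 #|A| <= #|D|]. *)
have h1 := leq_mul (leqnn #|D|) kM; have h2 := leq_mul (leqnn #|A|) D2A.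
have := leq_trans (sum_gain A D) (leq_add sD (leqnn _)).
by move: (k * M)%N #|A| #|D| h1 h2 kM D2A A0 => u v w; nia.
Qed.

Definition spread A B : {set 'F_p} :=
  [set x + \sum_(b in (S : {set 'F_p})) b | x in A, S in powerset B].

Lemma sub_spread A B : A \subset spread A B.
Proof.
apply/subsetP => x xA; apply/imset2P; exists x set0; rewrite ?powersetE ?sub0set //.
by rewrite big_set0 addr0.
Qed.

(** Transferring an element of [B] into [A] creates no new sums; both inductions below consume [B]
    in this way. *)
Lemma spread_step A B b : b \in B ->
  spread (A :|: translate b A) (B :\ b) \subset spread A B.
Proof.
move=> bB; apply/subsetP => z /imset2P[x S]; rewrite powersetE => + SB ->.
have SB' : S \subset B by apply: subset_trans SB (subsetDl _ _).
rewrite inE mem_translate => /orP[xA|xA]; apply/imset2P.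
  by exists x S; rewrite ?powersetE.
exists (x - b) (b |: S); rewrite ?powersetE ?subUset ?sub1set ?bB //.
have bS : b \notin S by apply/negP => /(subsetP SB); rewrite !inE eqxx.
by rewrite big_setU1 //= addrA subrK.
Qed.

Lemma card_union_translate A b : #|A :|: translate b A| = (#|A| + gain A b)%N.
Proof.
by rewrite cardsU card_translate setIC -(gainE A b) addnA addnK -addnA addnC.
Qed.

Lemma disjoint_oppD1 B b : [disjoint B & [set - x | x in B]] ->
  [disjoint B :\ b & [set - x | x in B :\ b]].
Proof.
move=> BN; apply: disjointWl (subsetDl _ _) _; apply: disjointWr BN.
exact: imsetS (subsetDl _ _).
Qed.

(* As long as m elements of B are unused, some unused element gains at least
   m / 4, and 1 + ... + m = m (m + 1) / 2. *)
Lemma spread_quadratic m A B : [disjoint B & [set - b | b in B]] ->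
  (0 < #|A|)%N -> (m <= #|B|)%N -> (m <= 2 * #|A|)%N ->
  (p < 2 * #|spread A B| \/ 8 * #|A| + m * m.+1 <= 8 * #|spread A B|)%N.
Proof.
elim: m A B => [|m IH] A B BN A0 mB mA.
  by right; rewrite addn0 leq_mul2l subset_leq_card ?sub_spread.
have [Ap|Ap] := ltnP p (2 * #|A|).
  by left; apply: leq_trans Ap _; rewrite leq_mul2l subset_leq_card ?sub_spread.
(* The quotient of [#|A|] by [m.+1], rounded up. *)
pose k := ((#|A| + m) %/ m.+1)%N.
have kA : (#|A| <= k * m.+1)%N by rewrite /k; have := ltn_ceil (#|A| + m) (ltn0Sn m); lia.
have kA' : (k * m.+1 <= #|A| + m)%N by rewrite leq_divM.
have [b bB gb] : exists2 b, b \in B & (#|A| <= 2 * k * gain A b)%N.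
  by apply: exists_gain => //; apply: leq_trans kA _; rewrite leq_mul2l mB orbT.
have g4 : (m.+1 <= 4 * gain A b)%N.
  (* For [k = 1] the bound follows from [m.+1 <= 2 #|A|]. For [k >= 2], [#|A| > (k - 1) (m + 1)] and
     [(k - 1) / (2 k) >= 1/4]. *)
  move: kA kA' gb mA A0; move: k #|A| (gain A b) => {}k u g; clear.
  case: k => [|[|k]]; [lia|lia|] => _ h1 h2 _ u0.
  rewrite leqNgt; apply/negP => h3; nia.
have cA1 := card_union_translate A b.
have [||||h|h] := IH (A :|: translate b A) (B :\ b).
- exact: disjoint_oppD1.
- by rewrite cA1 addn_gt0 A0.
- by move: mB; rewrite (cardsD1 b B) bB.
- by rewrite cA1; lia.
- by left; apply: leq_trans h _; rewrite leq_mul2l subset_leq_card ?spread_step.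
right; have := subset_leq_card (spread_step A bB); rewrite cA1 in h.
by move: h g4; nia.
Qed.

(* While 2|A| < n some element multiplies |A| by at least 3/2, so j steps bring
   [spread_quadratic] into play. *)
Lemma spread_exponential j n A B : [disjoint B & [set - b | b in B]] ->
  (0 < #|A|)%N -> (n + j <= #|B|)%N -> (2 ^ j * n <= 2 * (3 ^ j * #|A|))%N ->
  (p < 2 * #|spread A B| \/ n * n.+1 <= 8 * #|spread A B|)%N.
Proof.
elim: j A B => [|j IH] A B BN A0 nB nA.
  case: (@spread_quadratic n A B) => //; first by rewrite addn0 in nB.
  - by rewrite expn0 !mul1n in nA.
  - by left.
  by move=> h; right; apply: leq_trans h; rewrite leq_addl.
have [nA'|An] := leqP n (2 * #|A|).
  case: (@spread_quadratic n A B) => //; first by apply: leq_trans nB; rewrite leq_addr.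
  - by left.
  by move=> h; right; apply: leq_trans h; rewrite leq_addl.
have [Ap|Ap] := ltnP p (2 * #|A|).
  by left; apply: leq_trans Ap _; rewrite leq_mul2l subset_leq_card ?sub_spread.
have [b bB gb] : exists2 b, b \in B & (#|A| <= 2 * 1 * gain A b)%N.
  by apply: exists_gain => //; move: nB An; lia.
have cA1 := card_union_translate A b.
have [||||h|h] := IH (A :|: translate b A) (B :\ b).
- exact: disjoint_oppD1.
- by rewrite cA1 addn_gt0 A0.
- by move: nB; rewrite (cardsD1 b B) bB; lia.
- by rewrite cA1; move: nA gb; rewrite !expnS; nia.
- by left; apply: leq_trans h _; rewrite leq_mul2l subset_leq_card ?spread_step.
by right; apply: leq_trans h _; rewrite leq_mul2l subset_leq_card ?spread_step.
Qed.

(** Each of [B1] and [B2] alone has more than [p / 2] subset sums, so the sums [X] of [B1] and the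
    reflected set [r - Y] must meet. The condition on [j] lets the growth start from a single point;
    the one on [n] makes [n (n + 1) / 8] reach [p / 2], and oddness of [p] makes this strict. *)
Lemma subset_sums_full j n (B1 B2 : {set 'F_p}) (r : 'F_p) : odd p ->
  [disjoint B1 & [set - b | b in B1]] -> [disjoint B2 & [set - b | b in B2]] ->
  (n + j <= #|B1|)%N -> (n + j <= #|B2|)%N ->
  (2 ^ j * n <= 2 * 3 ^ j)%N -> (4 * p <= n * n.+1)%N ->
  exists S1 S2 : {set 'F_p}, [/\ S1 \subset B1, S2 \subset B2
                   & \sum_(b in S1) b + \sum_(b in S2) b = r].
Proof.
move=> p_odd B1N B2N nB1 nB2 jn np.
have big (B : {set 'F_p}) : [disjoint B & [set - b | b in B]] -> (n + j <= #|B|)%N ->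
    (p < 2 * #|spread [set 0%R] B|)%N.
  move=> BN nB; case: (@spread_exponential j n [set 0] B) => //; rewrite ?cards1 ?muln1 //.
  by move=> h; move: p_odd np h; move: #|spread [set 0%R] B| (n * n.+1)%N => u v; lia.
have := big B1 B1N nB1; have := big B2 B2N nB2.
set X := spread _ B1; set Y := spread _ B2 => Yp Xp.
pose Z := [set r - y | y in Y].
have cZ : #|Z| = #|Y| by rewrite card_imset // => u v /addrI/oppr_inj.
have : (0 < #|X :&: Z|)%N.
  have := cardsUI X Z; rewrite cZ.
  have : (#|X :|: Z| <= p)%N by rewrite -[leqRHS](card_Fp p_pr) max_card.
  by move: Xp Yp; move: #|X| #|Y| #|X :|: Z| #|X :&: Z| => a b c d; lia.
case/card_gt0P => x; rewrite inE => /andP[/imset2P[_ S1 /set1P-> + ->]].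
rewrite powersetE add0r => S1B /imsetP[_ /imset2P[_ S2 /set1P-> + ->]].
by rewrite powersetE add0r => S2B eqx; exists S1, S2; split => //; rewrite eqx subrK.
Qed.

End CauchyDavenport.

Local Open Scope nat_scope.

(** * Primes below q and their cofactors *)

Definition primes_below (q : nat) : seq nat := [seq r <- iota 0 q | prime r].
Definition primorial (q : nat) : nat := \prod_(r <- primes_below q) r.
Definition cofactor_sum (q : nat) (S : seq nat) : nat :=
  \sum_(x <- S) primorial q %/ x.

(** For [q = p N.+1] this is the bound [Y0 N <= sigma1 N / 6 - q], with a subset of [D1 N] encoded
    by the list of primes that are divided out. *)
Definition good (q : nat) : Prop :=
  forall r : nat, exists S : seq nat,
    [/\ uniq S, {subset S <= primes_below q}, cofactor_sum q S = r %[mod q]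
      & 6 * (cofactor_sum q S + q) <= cofactor_sum q (primes_below q)].

Lemma mem_primes_below q r : (r \in primes_below q) = prime r && (r < q).
Proof. by rewrite mem_filter mem_iota. Qed.

Lemma primes_below_uniq q : uniq (primes_below q).
Proof. by rewrite filter_uniq ?iota_uniq. Qed.

Lemma primes_below_cat c q : c <= q ->
  primes_below q = primes_below c ++ [seq r <- iota c (q - c) | prime r].
Proof. by move=> cq; rewrite -filter_cat -{2}[c]add0n -iotaD subnKC. Qed.

Lemma dvdn_primorial q r : r \in primes_below q -> r %| primorial q.
Proof. by move=> rq; rewrite /primorial (big_rem r) //= dvdn_mulr. Qed.

Lemma coprime_primorial q : prime q -> coprime q (primorial q).
Proof.
move=> q_pr; rewrite /primorial big_seq.
apply: (big_ind (fun m => coprime q m)) => [|m n qm qn|r]; first exact: coprimen1.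
  by rewrite coprimeMr qm.
rewrite mem_primes_below => /andP[r_pr rq].
by rewrite prime_coprime // dvdn_prime2 // eq_sym; apply: contraTneq rq => ->; rewrite ltnn.
Qed.

Lemma primorial_ge q : 2 ^ size (primes_below q) <= primorial q.
Proof.
rewrite /primorial; set s := primes_below q.
have : all prime s by apply: filter_all.
elim: s => [|r s IH] /=; first by rewrite big_nil.
by case/andP=> /prime_gt1 r1 /IH {}IH; rewrite big_cons expnS leq_mul.
Qed.

(** Reciprocals are measured in units of [1/K]: rounding down bounds the full sum from below here,
    rounding up bounds a chosen subsum from above in the lemma [cofactor_sum_le]. *)
Lemma cofactor_sum_ge K c q : c <= q ->
  primorial q * \sum_(x <- primes_below c) K %/ x
    <= K * cofactor_sum q (primes_below q).
Proof.
move=> cq; rewrite /cofactor_sum [in leqRHS](primes_below_cat cq) big_cat /=.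
rewrite mulnDr (leq_trans _ (leq_addr _ _)) // !big_distrr /=.
rewrite big_seq [leqRHS]big_seq; apply: leq_sum => r rc.
have /dvdn_primorial rM : r \in primes_below q.
  by rewrite (primes_below_cat cq) mem_cat rc.
rewrite -{1}(divnK rM) -mulnA [leqRHS]mulnC leq_mul2l mulnC leq_divM.
by rewrite orbT.
Qed.

Lemma cofactor_sum_le K q S : {subset S <= primes_below q} ->
  K * cofactor_sum q S <= primorial q * \sum_(x <- S) (K %/ x).+1.
Proof.
move=> Sq; rewrite /cofactor_sum !big_distrr /= big_seq [leqRHS]big_seq.
apply: leq_sum => r /Sq rq; have rM := dvdn_primorial rq.
rewrite -{2}(divnK rM) -mulnA [leqLHS]mulnC leq_mul2l [leqRHS]mulnC.
rewrite ltnW ?orbT // ltn_ceil //; apply: prime_gt0.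
by move: rq; rewrite mem_primes_below => /andP[].
Qed.

Lemma cofactor_sum_Fp q S : prime q -> {subset S <= primes_below q} ->
  ((cofactor_sum q S)%:R =
    (primorial q)%:R * \sum_(x <- S) (x%:R)^-1 :> 'F_q)%R.
Proof.
move=> q_pr Sq; rewrite /cofactor_sum natr_sum big_distrr /= big_seq [RHS]big_seq.
apply: eq_bigr => r /Sq rq; rewrite -{2}(divnK (dvdn_primorial rq)) natrM mulfK //.
move: rq; rewrite mem_primes_below => /andP[r_pr rq].
by rewrite -(dvdn_pcharf (pchar_Fp q_pr)) gtnNdvd ?prime_gt0.
Qed.

Lemma primorial_Fp_neq0 q : prime q -> ((primorial q)%:R != 0 :> 'F_q)%R.
Proof.
move=> q_pr; rewrite -(dvdn_pcharf (pchar_Fp q_pr)) -prime_coprime //.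
exact: coprime_primorial.
Qed.

Lemma natr_eq_Fp q m n : prime q -> (m%:R == n%:R :> 'F_q)%R = (m == n %[mod q]).
Proof.
move=> q_pr; apply/eqP/eqP => [/(congr1 val) /=|mn].
  by rewrite !val_Fp_nat.
by apply: val_inj; rewrite /= !val_Fp_nat.
Qed.

(** * Large q *)

(** Each pair [2i, 2i + 1] with [i >= 2] holds at most one prime, and the empty pair [0, 1] makes up
    for [2, 3]. *)
Lemma size_primes_below_double m : size (primes_below (2 * m)) <= m.
Proof.
case: m => [|[|m]] //; elim: m => [|m IH] //.
rewrite (@primes_below_cat (2 * m.+2)) ?leq_mul2l ?leqnSn ?orbT // size_cat.
have -> : 2 * m.+3 - 2 * m.+2 = 2 by lia.
rewrite -[leqRHS]addn1 leq_add //=.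
have /negbTE-> : ~~ prime (2 * m.+2) by apply/primePn; right; exists 2; rewrite ?dvdn_mulr //; lia.
by case: ifP.
Qed.

Lemma size_large_primes q k :
  size (primes_below q) <= k + size [seq r <- primes_below q | 2 * k <= r].
Proof.
have := count_predC (leq (2 * k)) (primes_below q).
rewrite -!size_filter addnC => <-; rewrite leq_add2r; apply: leq_trans (size_primes_below_double k).
apply: uniq_leq_size; first by rewrite filter_uniq ?primes_below_uniq.
move=> r; rewrite mem_filter /= -ltnNge => /andP[rk].
by rewrite !mem_primes_below rk => /andP[->].
Qed.

Section Inverses.
Variable q : nat.
Hypotheses (q_pr : prime q) (q_odd : odd q).

Let inv (x : nat) : 'F_q := (x%:R^-1)%R.

Lemma natr_prime_below_neq0 x : x \in primes_below q -> (x%:R != 0 :> 'F_q)%R.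
Proof.
rewrite mem_primes_below => /andP[x_pr xq].
by rewrite -(dvdn_pcharf (pchar_Fp q_pr)) gtnNdvd ?prime_gt0.
Qed.

Lemma inv_prime_inj : {in primes_below q &, injective inv}.
Proof.
move=> x y xq yq /invr_inj/eqP; rewrite natr_eq_Fp //.
move: xq yq; rewrite !mem_primes_below => /andP[_ xq] /andP[_ yq].
by rewrite !modn_small // => /eqP.
Qed.

(* 1/x + 1/y = 0 would force x + y = q, against parity. *)
Lemma inv_primes_asym (w : seq nat) : {subset w <= primes_below q} ->
  {in w, forall x, 2 < x} ->
  [disjoint [set b in map inv w] & [set (- b)%R | b in [set b in map inv w]]].
Proof.
move=> wq w2; rewrite -setI_eq0; apply/eqP/setP => b; rewrite !inE.
apply/negP => /andP[/mapP[x xw bx] /imsetP[c]]; rewrite inE => /mapP[y yw ->].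
rewrite bx /inv -invrN => /invr_inj/eqP; rewrite -subr_eq0 opprK -natrD.
rewrite -(dvdn_pcharf (pchar_Fp q_pr)) => /dvdnP[k eqk].
have := wq _ xw; have := wq _ yw; rewrite !mem_primes_below.
case/andP=> y_pr yq /andP[x_pr xq].
have xo : odd x by case: (even_prime x_pr) (w2 _ xw) => [->|].
have yo : odd y by case: (even_prime y_pr) (w2 _ yw) => [->|].
have k1 : k = 1 by case: k eqk (w2 _ xw) => [|[|k]] //; nia.
move: eqk; rewrite k1 mul1n => xyq.
by move: q_odd; rewrite -xyq oddD xo yo.
Qed.

Lemma card_inv_set (w : seq nat) : uniq w -> {subset w <= primes_below q} ->
  #|[set b in map inv w]| = size w.
Proof.
move=> uw wq; rewrite cardsE -(size_map inv w); apply/card_uniqP.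
by rewrite map_inj_in_uniq // => x y /wq xq /wq yq; exact: inv_prime_inj.
Qed.

Lemma sum_inv_filter (w : seq nat) (S : {set 'F_q}) : uniq w ->
  {subset w <= primes_below q} -> S \subset [set b in map inv w] ->
  (\sum_(b in S) b = \sum_(x <- [seq x <- w | inv x \in S]) inv x)%R.
Proof.
move=> uw wq Sw; rewrite big_filter -(big_map inv (mem S) id) -[RHS]big_filter -[LHS]big_enum.
apply: perm_big; apply: uniq_perm.
- exact: enum_uniq.
- by rewrite filter_uniq // map_inj_in_uniq // => x y /wq xq /wq yq; exact: inv_prime_inj.
move=> b; rewrite mem_enum mem_filter /=.
by case: (boolP (b \in S)) => //= /(subsetP Sw); rewrite inE.
Qed.

End Inverses.

(** With [u = 2 (x + 1) + j], at most [3u] primes lie below [6u], so [5u] primes leave two disjoint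
    batches of [u] primes, each at least [6u]. Their reciprocals add up to at most 1/3, while those
    of all primes below 300 add up to more than 2; this is the origin of the bound 300. *)
Lemma good_of_count q x j : prime q -> 300 <= q -> 7 <= x -> q < x.+1 ^ 2 ->
  x.+1 * 2 ^ j <= 3 ^ j -> 5 * (2 * x.+1 + j) <= size (primes_below q) -> good q.
Proof.
move=> q_pr q300 x7 qx xj; set u := 2 * x.+1 + j => uN.
have u0 : 0 < u by rewrite /u; lia.
have q_odd : odd q by case: (even_prime q_pr) q300 => [->|].
set W := [seq r <- primes_below q | 2 * (3 * u) <= r].
have sW : 2 * u <= size W by have := size_large_primes q (3 * u); rewrite -/W; lia.
have uW : uniq W by rewrite filter_uniq ?primes_below_uniq.
have Wq : {subset W <= primes_below q} by move=> y; rewrite mem_filter => /andP[].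
have Wu : {in W, forall y, 6 * u <= y}.
  by move=> y; rewrite mem_filter mulnA => /andP[].
have W2 : {in W, forall y, 2 < y} by move=> y /Wu; rewrite /u; lia.
set w1 := take u W; set w2 := take u (drop u W).
have w1W : {subset w1 <= W} by move=> y /mem_take.
have w2W : {subset w2 <= W} by move=> y /mem_take/mem_drop.
have uw : uniq (w1 ++ w2).
  have -> : w1 ++ w2 = take (u + u) W by rewrite takeD.
  exact: take_uniq.
have [sw1 sw2] : size w1 = u /\ size w2 = u.
  by rewrite !size_takel ?size_drop //; lia.
have [uw1 uw2] : uniq w1 /\ uniq w2 by move: uw; rewrite cat_uniq => /and3P[].
move=> r; pose inv (y : nat) : 'F_q := (y%:R^-1)%R.
pose B1 := [set b in map inv w1]; pose B2 := [set b in map inv w2].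
have w1q y : y \in w1 -> y \in primes_below q by move/w1W/Wq.
have w2q y : y \in w2 -> y \in primes_below q by move/w2W/Wq.
have [|||||||S1 [S2 [S1B S2B S12]]] := @subset_sums_full q q_pr j (2 * x.+1) B1 B2
  (r%:R / (primorial q)%:R)%R.
- exact: q_odd.
- by apply: inv_primes_asym => // y /w1W/W2.
- by apply: inv_primes_asym => // y /w2W/W2.
- by rewrite card_inv_set // sw1.
- by rewrite card_inv_set // sw2.
- by rewrite [leqLHS]mulnCA leq_mul2l mulnC.
- by move: qx; nia.
set s1 := [seq y <- w1 | inv y \in S1]; set s2 := [seq y <- w2 | inv y \in S2].
have sub_s : subseq (s1 ++ s2) (w1 ++ w2) by rewrite cat_subseq ?filter_subseq.
have sq : {subset s1 ++ s2 <= primes_below q}.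
  by move=> y /(mem_subseq sub_s); rewrite mem_cat => /orP[/w1q|/w2q].
exists (s1 ++ s2); split => //; first exact: subseq_uniq sub_s uw.
  apply/eqP; rewrite -natr_eq_Fp // cofactor_sum_Fp // big_cat /=.
  rewrite -(@sum_inv_filter q q_pr w1 S1) // -(@sum_inv_filter q q_pr w2 S2) //.
  by rewrite S12 mulrC divfK // primorial_Fp_neq0.
have sumle : 3 * cofactor_sum q (s1 ++ s2) <= primorial q.
  have size_s : size (s1 ++ s2) <= 2 * u.
    by rewrite (leq_trans (size_subseq sub_s)) // size_cat sw1 sw2 addnn mul2n.
  rewrite -(@leq_pmul2l (2 * u)) ?muln_gt0 //.
  apply: leq_trans (_ : size (s1 ++ s2) * primorial q <= _); last by rewrite leq_mul2r size_s orbT.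
  rewrite mulnA /cofactor_sum big_distrr /= -sum1_size big_distrl /=.
  rewrite big_seq [leqRHS]big_seq; apply: leq_sum => y ys.
  rewrite mul1n -[leqRHS](divnK (dvdn_primorial (sq _ ys))) mulnC leq_mul2l.
  have : y \in W by move: (mem_subseq sub_s ys); rewrite mem_cat => /orP[/w1W|/w2W].
  by move=> /Wu; rewrite mulnAC => ->; rewrite orbT.
(* The existential keeps [10 ^ 4] and 16 as variables in the arithmetic that follows. *)
have [K [e [K0 e16 Ke sumK]]] : exists K e, [/\ 0 < K, e <= 16, 6 * K <= 2 ^ e
    & 2 * K < \sum_(y <- primes_below 300) K %/ y].
  exists (10 ^ 4), 16; split; [by []|by []|by vm_compute|].
  by rewrite -(big_map _ predT id) -sumnE; vm_compute.
(* The term [6 q] is absorbed because the primorial is at least 2 to the number of primes. *)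
have Mq : 6 * K * q <= primorial q.
  apply: leq_trans (primorial_ge q).
  apply: leq_trans (_ : 2 ^ (e + x.+1 * 2) <= _); last first.
    by rewrite leq_exp2l //; clear -uN e16 x7; rewrite /u in uN; lia.
  rewrite expnD expnM leq_mul //.
  by apply: leq_trans (ltnW qx) _; rewrite leq_exp2r // ltnW // ltn_expl.
rewrite -(leq_pmul2l K0); apply: leq_trans (cofactor_sum_ge K q300).
apply: leq_trans (_ : primorial q * (2 * K).+1 <= _); last by rewrite leq_mul2l sumK orbT.
by move: Mq sumle; move: (cofactor_sum _ _) (primorial q); clear => v w; nia.
Qed.

(** * Chebyshev's lower bound *)

Lemma bin_central h : 'C(2 * h, h) * (h`! * h`!) = (2 * h)`!.
Proof. by rewrite -(@bin_fact (2 * h) h) ?mul2n -?addnn ?addKn ?leq_addr. Qed.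

(** Once factorials are cleared, the induction step is [4 (h + 1)^2 <= (2 h + 2) (2 h + 3)]. *)
Lemma expn4_le_bin h : 4 ^ h <= (2 * h).+1 * 'C(2 * h, h).
Proof.
rewrite -(@leq_pmul2r (h`! * h`!)) ?muln_gt0 ?fact_gt0 // -mulnA bin_central.
elim: h => [|h IH]; first by [].
have -> : 2 * h.+1 = (2 * h).+2 by lia.
rewrite expnS (factS h) (factS (2 * h).+1) (factS (2 * h)).
by move: IH; move: (4 ^ h) (h`!) (2 * h)`! => u v w; nia.
Qed.

(* Legendre: the k-th term of logn p C(2h,h) is at most 1, and is 0 once
   p ^ k > 2h. *)
Lemma pfactor_bin_central_le p h : prime p -> 0 < h ->
  p ^ logn p 'C(2 * h, h) <= 2 * h.
Proof.
move=> p_pr h0; have p1 := prime_gt1 p_pr.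
have h20 : 0 < 2 * h by rewrite muln_gt0.
apply: leq_trans (trunc_logP p1 h20); rewrite leq_exp2l //.
set t := trunc_log p (2 * h).
have C0 : 0 < 'C(2 * h, h) by rewrite bin_gt0 leq_pmull.
have := congr1 (logn p) (bin_central h).
rewrite !lognM ?muln_gt0 ?fact_gt0 // !logn_fact // => eqC.
have extend : \sum_(1 <= k < h.+1) h %/ p ^ k = \sum_(1 <= k < (2 * h).+1) h %/ p ^ k.
  rewrite [RHS](@big_cat_nat _ _ _ h.+1) //=; last by lia.
  rewrite [X in _ = _ + X](_ : _ = 0) ?addn0 // big_nat big1 // => k /andP[hk _].
  by rewrite divn_small // (leq_trans hk) // ltnW // ltn_expl.
move: eqC; rewrite extend -big_split /= => eqC.
have : \sum_(1 <= k < (2 * h).+1) 2 * h %/ p ^ k <=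
    \sum_(1 <= k < (2 * h).+1) (k <= t) +
    \sum_(1 <= k < (2 * h).+1) (h %/ p ^ k + h %/ p ^ k).
  rewrite -big_split /=; apply: leq_sum => k _.
  have [kt|tk] := leqP k t.
    have pk0 : 0 < p ^ k by rewrite expn_gt0 prime_gt0.
    have := leq_divM (2 * h) (p ^ k); have := ltn_ceil h pk0; rewrite /= add1n.
    move: (h %/ p ^ k) (2 * h %/ p ^ k) (p ^ k) => u v w; nia.
  by rewrite divn_small // (leq_trans (trunc_log_ltn _ p1)) // leq_exp2l.
rewrite -eqC leq_add2r => /leq_trans; apply.
rewrite -big_mkcond /= sum1_count -size_filter -[leqRHS](size_iota 1 t).
apply: uniq_leq_size; first by rewrite filter_uniq ?iota_uniq.
by move=> k; rewrite mem_filter mem_index_iota mem_iota => /and3P[kt -> _].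
Qed.

(** Chebyshev's argument: with [q = 2 h + 1], every prime dividing ['C(2 * h, h)] is below [q] and
    contributes a factor below [2 ^ s], so [4 ^ h <= q * 2 ^ (s * n) < 2 ^ (s * n.+1)]. *)
Lemma primes_below_count q s : prime q -> 2 < q -> q < 2 ^ s ->
  q <= s * (size (primes_below q)).+1.
Proof.
move=> q_pr q2 qs; set n := size _.
have q_odd : odd q by case: (even_prime q_pr) q2 => [->|].
pose h := q./2; have qh : q = (2 * h).+1 by rewrite mul2n -[LHS]odd_double_half q_odd.
have h0 : 0 < h by lia.
have C0 : 0 < 'C(2 * h, h) by rewrite bin_gt0 leq_pmull.
have le_C : 'C(2 * h, h) <= 2 ^ (s * n).
  rewrite expnM {1}(prod_prime_decomp C0) prime_decompE big_map /=.
  apply: (@leq_trans (\prod_(p <- primes 'C(2 * h, h)) 2 ^ s)).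
    rewrite big_seq [leqRHS]big_seq; apply: leq_prod => p; rewrite mem_primes.
    case/and3P=> p_pr _ _; apply: leq_trans (pfactor_bin_central_le p_pr h0) _.
    by rewrite ltnW // ltnW // -qh.
  rewrite big_const_seq count_predT iter_muln muln1 -!expnM leq_exp2l //.
  rewrite leq_mul2l; apply/orP; right; apply: uniq_leq_size; first exact: primes_uniq.
  move=> p; rewrite mem_primes mem_primes_below => /and3P[p_pr _ pC].
  have ndvd_fact m : m < p -> ~~ (p %| m`!).
    elim: m => [|m IH] mp; first by rewrite fact0 dvdn1 neq_ltn (prime_gt1 p_pr) orbT.
    by rewrite factS Euclid_dvdM // negb_or gtnNdvd //= IH // ltnW.
  rewrite p_pr qh ltnS /= leqNgt; apply: contraL pC => /ndvd_fact.
  by apply: contra => /dvdn_trans; apply; rewrite -bin_central dvdn_mulr.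
have : 2 ^ (2 * h) < 2 ^ (s * n.+1).
  rewrite expnM (leq_ltn_trans (expn4_le_bin h)) // -qh mulnS expnD.
  by rewrite (leq_ltn_trans (leq_mul (leqnn _) le_C)) // ltn_pmul2r ?expn_gt0.
by rewrite ltn_exp2l // qh.
Qed.

Lemma sqrt_floor q : exists x, x ^ 2 <= q < x.+1 ^ 2.
Proof.
elim: q => [|q [x /andP[xq qx]]]; first by exists 0.
have [lt|ge] := ltnP q.+1 (x.+1 ^ 2).
  by exists x; rewrite lt andbT (leq_trans xq).
by exists x.+1; rewrite ge; apply: leq_ltn_trans qx _; rewrite ltn_exp2r.
Qed.

Lemma quad_le_exp2 t : 16 <= t -> 121 * t.+1 ^ 2 <= 2 ^ t.
Proof.
move=> t16; rewrite -(subnK t16); elim: (t - 16) => [|n IH]; first by lia.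
by rewrite addSn (expnS 2) -mulnn; move: IH; rewrite -mulnn; move: (2 ^ _) => u; nia.
Qed.

(** Squaring and using [(x + 1)^2 <= 4 * 2 ^ s] reduces this to [4 * 8 ^ s <= 9 ^ s]. *)
Lemma exp2_sqr_le_exp3 s x : 16 <= s -> x ^ 2 < 2 ^ s -> 0 < x -> x.+1 * 2 ^ s <= 3 ^ s.
Proof.
move=> s16 xs x0; rewrite -leq_sqr expnMn -!expnM ![s * 2]mulnC !expnM.
apply: leq_trans (_ : 4 * 2 ^ s * 4 ^ s <= _).
  by rewrite leq_mul2r; apply/orP; right; nia.
rewrite -mulnA -expnMn -(subnK s16); elim: (s - 16) => [|n IH]; first by lia.
by rewrite addSn !expnS; move: IH; move: (_ ^ _) (_ ^ _) => u v; lia.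
Qed.

Lemma good_large q : prime q -> 182 ^ 2 <= q -> good q.
Proof.
move=> q_pr q182; have [x /andP[xq qx]] := sqrt_floor q.
have x182 : 182 <= x.
  by rewrite -ltnS -(@ltn_exp2r _ _ 2) // (leq_ltn_trans q182).
set s := (trunc_log 2 q).+1.
have q0 : 0 < q by exact: prime_gt0.
have qs : q < 2 ^ s by apply: trunc_log_ltn.
have sq : 2 ^ s.-1 <= q by apply: trunc_logP.
have s16 : 16 <= s.
  rewrite -ltnS ltnNge; apply/negP => s15.
  have : 2 ^ s <= 2 ^ 15 by rewrite leq_exp2l.
  by move: qs q182; clear; move: (2 ^ s) => u; lia.
(* Since [121 = 11 ^ 2], this yields [11 s <= x]. The case [s = 16] rests on [q >= 182 ^ 2] instead
   of on growth. *)
have s11 : 121 * s ^ 2 <= q.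
  have [s17|] := leqP 17 s.
    by apply: leq_trans sq; case: (s) s17 => // t; exact: quad_le_exp2.
  rewrite ltnS => s16'; apply: leq_trans q182.
  apply: (@leq_trans (121 * 16 ^ 2)); last by clear; lia.
  by rewrite leq_mul2l leq_exp2r.
have sx : 11 * s <= x.
  by rewrite -ltnS -(@ltn_exp2r _ _ 2) // (leq_ltn_trans _ qx) // expnMn.
have N := primes_below_count q_pr _ qs.
apply: (@good_of_count q x s) => //.
- by lia.
- by lia.
- by apply: exp2_sqr_le_exp3 => //; [exact: leq_ltn_trans xq qs | lia].
have {}N : q <= s * (size (primes_below q)).+1 by apply: N; lia.
rewrite leqNgt; apply/negP => lt.
(* Too few primes would give [x^2 <= 10 s (x + 1) + 5 s^2], impossible for [s <= x / 11] and
   [x >= 182]. *)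
have : x ^ 2 <= s * (5 * (2 * x.+1 + s)).
  by rewrite (leq_trans xq) // (leq_trans N) // leq_mul2l lt orbT.
by move: sx x182; clear; nia.
Qed.

(** * Computations in binary arithmetic *)

Lemma to_nat_mod m d : N.to_nat (N.modulo m d) = N.to_nat m %% N.to_nat d.
Proof.
have [->|d0] := N.eq_dec d 0; first by rewrite N.mod_0_r modn0.
have h := N.div_mod m d d0; have lt := N.mod_lt m d d0.
rewrite {2}h N2Nat.inj_add N2Nat.inj_mul plusE multE mulnC modnMDl modn_small //; lia.
Qed.

Lemma to_nat_div m d : d <> N0 -> N.to_nat (N.div m d) = N.to_nat m %/ N.to_nat d.
Proof.
move=> d0; have h := N.div_mod m d d0; have lt := N.mod_lt m d d0.
rewrite {2}h N2Nat.inj_add N2Nat.inj_mul plusE multE mulnC divnMDl; last by lia.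
by rewrite divn_small ?addn0 //; lia.
Qed.

Definition small_primes : seq N := Eval vm_compute in
  [seq N.of_nat r | r <- primes_below 182].

Fixpoint trial (ds : seq N) (n : N) : bool :=
  if ds is d :: ds' then
    if N.ltb n (d * d) then true
    else if N.modulo n d is N0 then false else trial ds' n
  else true.

Definition is_prime (n : N) : bool := if N.ltb 1 n then trial small_primes n else false.

(** In increasing order, every [d] tried up to [r] satisfies [d * d <= r * r <= n], so the early
    exit cannot occur before the divisor [r] is reached. *)
Lemma trial_composite ds n r : sorted leq (map N.to_nat ds) ->
  r \in map N.to_nat ds -> r * r <= N.to_nat n -> r %| N.to_nat n -> trial ds n = false.
Proof.
move=> + + rn rdvd; elim: ds => //= d ds IH; rewrite (path_sortedE leq_trans).
case/andP=> /allP d_min /IH {}IH; rewrite inE => r_in.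
have dr : N.to_nat d <= r by case/predU1P: r_in => [->|/d_min].
case: N.ltb_spec => [nd|_].
  by have := leq_mul dr dr; move: nd rn; lia.
case/predU1P: r_in => [rd|/IH ->]; last by case: (N.modulo _ _).
suff -> : N.modulo n d = N0 by [].
by apply: N2Nat.inj; rewrite to_nat_mod -rd; apply/eqP.
Qed.

Lemma trial_prime ds n : prime (N.to_nat n) -> all (leq 2) (map N.to_nat ds) ->
  trial ds n.
Proof.
move=> n_pr; elim: ds => //= d ds IH /andP[d2 /IH ->].
case: N.ltb_spec => // dn.
case E : (N.modulo n d) => //.
have : N.to_nat d %| N.to_nat n by rewrite /dvdn -to_nat_mod E.
case/primeP: n_pr => _ dP /dP/pred2P[|] eqd; first by move: d2; rewrite eqd.
by have dn' := N2Nat.inj _ _ eqd; move: dn d2; rewrite dn'; nia.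
Qed.

Lemma trialE ds b n : map N.to_nat ds = primes_below b -> 1 < N.to_nat n ->
  N.to_nat n < b ^ 2 -> trial ds n = prime (N.to_nat n).
Proof.
move=> dsE n1 nb; have [n_pr|n_npr] := boolP (prime _).
  apply: trial_prime => //; rewrite dsE; apply/allP => r.
  by rewrite mem_primes_below => /andP[/prime_gt1].
have n0 := ltnW n1; have pp : prime (pdiv (N.to_nat n)) by rewrite pdiv_prime.
have pn : pdiv (N.to_nat n) * pdiv (N.to_nat n) <= N.to_nat n.
  by rewrite leqNgt; apply: contra n_npr => ?; apply: ltn_pdiv2_prime.
apply: (trial_composite _ _ pn (pdiv_dvd _)); rewrite dsE.
  by apply: sorted_filter; [exact: leq_trans | exact: iota_sorted].
rewrite mem_primes_below pp /= ltnNge; apply/negP => le_b.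
by have := leq_trans (leq_mul le_b le_b) pn; rewrite mulnn leqNgt nb.
Qed.

Lemma is_primeE n : N.to_nat n < 182 ^ 2 -> is_prime n = prime (N.to_nat n).
Proof.
rewrite /is_prime; case: N.ltb_spec => n1; last first.
  move=> _; apply/esym/negbTE/negP => /prime_gt1; lia.
by apply: trialE; [vm_compute | lia].
Qed.

Fixpoint iotaN (n : N) (k : nat) : seq N :=
  if k is k'.+1 then n :: iotaN (N.succ n) k' else [::].

Lemma map_iotaN n k : map N.to_nat (iotaN n k) = iota (N.to_nat n) k.
Proof. by elim: k n => //= k IH n; rewrite IH N2Nat.inj_succ. Qed.

Definition primesN (m : nat) : seq N := [seq n <- iotaN 0 m | is_prime n].

Lemma map_primesN m : m <= 182 ^ 2 -> map N.to_nat (primesN m) = primes_below m.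
Proof.
move=> m182; rewrite /primes_below -[0]/(N.to_nat 0) -map_iotaN filter_map.
congr map; apply: eq_in_filter => n nm; apply: is_primeE.
have : N.to_nat n \in iota 0 m by rewrite -[0]/(N.to_nat 0) -map_iotaN map_f.
by rewrite mem_iota => /andP[_ nm']; apply: leq_trans nm' m182.
Qed.

Definition table (l : seq N) : PositiveSet.t :=
  foldr (fun n s => if n is Npos x then PositiveSet.add x s else s) PositiveSet.empty l.

Definition in_table (s : PositiveSet.t) (n : N) : bool :=
  if n is Npos x then PositiveSet.mem x s else false.

Lemma in_tableP l n : in_table (table l) n -> n \in l.
Proof.
case: n => // x; elim: l => [|n l IH] //=.
case: n => [|y]; first by rewrite inE => /IH ->; rewrite orbT.
move/PositiveSet.mem_spec/PositiveSet.add_spec => [->|/PositiveSet.mem_spec/IH].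
  by rewrite mem_head.
by rewrite inE orbC => ->.
Qed.

(** * Certificates for goodness and their soundness *)

#[local] Arguments N.to_nat : simpl never.

(* Reciprocals are counted in units of 1/10000.  The primes below 31 already
   contribute more than 6 * 2555 such units to sigma1 / P. *)
Definition scale : N := 10000.
Definition cost (d : N) : N := N.succ (N.div scale d).
Definition budget : N := 2555.

Definition costn (x : nat) : nat := (N.to_nat scale %/ x).+1.

Lemma costE d : d <> N0 -> N.to_nat (cost d) = costn (N.to_nat d).
Proof. by move=> d0; rewrite N2Nat.inj_succ to_nat_div. Qed.

(** The rounded-down reciprocals of the primes below 31 total 15331 units, one more than [6 * 2555].
    The spare unit, worth [primorial q / 10000], pays for [6 q]. *)
Lemma cofactor_budget q S : 31 <= q -> 6 * N.to_nat scale * q <= primorial 31 ->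
  {subset S <= primes_below q} ->
  \sum_(x <- S) costn x <= N.to_nat budget ->
  6 * (cofactor_sum q S + q) <= cofactor_sum q (primes_below q).
Proof.
move=> q31 q_small Sq cS.
have primes31 : primes_below 31 = [:: 2; 3; 5; 7; 11; 13; 17; 19; 23; 29] by vm_compute.
have M31 : primorial 31 <= primorial q.
  rewrite /primorial (primes_below_cat q31) big_cat /= leq_pmulr //.
  rewrite big_seq; apply: prodn_cond_gt0 => r.
  by rewrite mem_filter => /andP[/prime_gt0].
have := cofactor_sum_le (N.to_nat scale) Sq.
have := cofactor_sum_ge (N.to_nat scale) q31.
have : 6 * N.to_nat budget < \sum_(y <- primes_below 31) N.to_nat scale %/ y.
  by rewrite -(big_map _ predT id) -sumnE primes31; vm_compute.
have := leq_trans q_small M31.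
move: cS; rewrite /costn; set s1 := \sum_(x <- S) _; set s2 := \sum_(x <- primes_below 31) _.
have : 0 < N.to_nat scale by [].
move: (N.to_nat scale) (N.to_nat budget) s1 s2 (cofactor_sum _ S) (cofactor_sum _ _) (primorial q).
clear => K B s1 s2 x y M K0 h1 h2 h3 h4 h5.
rewrite -(leq_pmul2l K0); apply: leq_trans h4.
have : M * (6 * s1).+1 <= M * s2 by rewrite leq_mul2l (leq_ltn_trans _ h3) ?orbT // leq_mul2l.
by move: h2 h5; nia.
Qed.

(** Multiplication by the units [t] and [primorial q] permutes the residues, so sums of [t / x] may
    replace the cofactor sums. *)
Lemma good_of_cover q (ds : seq nat) (t : 'F_q) : prime q -> 31 <= q ->
  6 * N.to_nat scale * q <= primorial 31 -> uniq ds -> {subset ds <= primes_below q} -> t != 0%R ->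
  (forall r : 'F_q, exists S, [/\ subseq S ds, \sum_(x <- S) costn x <= N.to_nat budget
     & (\sum_(x <- S) t / x%:R = r)%R]) ->
  good q.
Proof.
move=> q_pr q31 q_small uds dsq t0 cover r.
have [S [Sds cS Sr]] := cover (t * (r%:R / (primorial q)%:R))%R.
have Sq : {subset S <= primes_below q} by move=> x /(mem_subseq Sds)/dsq.
exists S; split => //; first exact: subseq_uniq uds.
  apply/eqP; rewrite -natr_eq_Fp // cofactor_sum_Fp //.
  move: Sr; rewrite -mulr_sumr => /(mulfI t0) ->.
  by rewrite mulrC divfK // primorial_Fp_neq0.
exact: cofactor_budget.
Qed.

Lemma leq_sum_subseq (f : nat -> nat) s1 s2 : subseq s1 s2 ->
  \sum_(x <- s1) f x <= \sum_(x <- s2) f x.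
Proof.
elim: s2 s1 => [|y s2 IH] [|x s1] //=; rewrite ?big_nil //.
case: eqP => [->|_] /IH; rewrite !big_cons ?leq_add2l // => /leq_trans; apply.
by rewrite leq_addl.
Qed.

Definition known_primes (tbl : PositiveSet.t) (q : N) (ds : seq N) : bool :=
  all (fun d => in_table tbl d && N.ltb d q) ds && uniq ds.

(* A list of pairs (d, c) is read from its end: t/d must be c or -c modulo q, and
   c at most one more than the sum of the entries c that follow it. *)
Fixpoint width (q t : N) (l : seq (N * N)) : option N :=
  if l is (d, c) :: l' then
    if width q t l' is Some W then
      if N.leb c (N.succ W) &&
         (N.eqb (N.modulo (d * c) q) t || N.eqb (N.modulo (d * c + t) q) 0)
      then Some (W + c)%num else None
    else None
  else Some N0.

Definition total_cost (ds : seq N) : N := foldr (fun d s => N.add (cost d) s) N0 ds.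

Definition certifies (tbl : PositiveSet.t) (q t : N) (l : seq (N * N)) : bool :=
  [&& known_primes tbl q (unzip1 l), N.ltb 0 t, N.ltb t q,
      (if width q t l is Some W then N.leb q (N.succ W) else false)
    & N.leb (total_cost (unzip1 l)) budget].

Fixpoint residues (q : N) (l : seq (N * N)) (r c : N) : seq N :=
  if N.ltb budget c then [::]
  else if l is (d, w) :: l' then
    residues q l' (r + w) (c + cost d) ++ residues q l' r c
  else [:: N.modulo r q].

Definition residues_full (tbl : PositiveSet.t) (q : N) (l : seq (N * N)) : bool :=
  [&& known_primes tbl q (unzip1 l),
      all (fun x => N.eqb (N.modulo (x.1 * x.2) q) 1) l
    & let rs := residues q l 0 0 in all (mem rs) (iotaN 0 (N.to_nat q))].

Section Soundness.
Variables (tbl : PositiveSet.t) (q : N).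
Hypothesis tbl_prime : forall d, in_table tbl d -> prime (N.to_nat d).
Let qn := N.to_nat q.
Hypotheses (q_pr : prime qn) (q31 : 31 <= qn)
  (q_small : 6 * N.to_nat scale * qn <= primorial 31).

Lemma known_primesP ds : known_primes tbl q ds ->
  uniq (map N.to_nat ds) /\ {subset map N.to_nat ds <= primes_below qn}.
Proof.
case/andP=> /allP dsP uds; split.
  by rewrite map_inj_uniq //; exact: N2Nat.inj.
move=> _ /mapP[d /dsP/andP[/tbl_prime d_pr dq] ->].
by rewrite mem_primes_below d_pr; move/N.ltb_spec0: dq; rewrite /qn; lia.
Qed.

Lemma total_costE ds : known_primes tbl q ds ->
  N.to_nat (total_cost ds) = \sum_(x <- map N.to_nat ds) costn x.
Proof.
case/andP=> /allP dsP _; elim: ds dsP => [|d ds IH] dsP; first by rewrite big_nil.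
rewrite big_cons -IH => [|e eds]; last by apply: dsP; rewrite inE eds orbT.
rewrite /= N2Nat.inj_add costE //.
by case/andP: (dsP d (mem_head _ _)) => /tbl_prime/prime_gt0; case: (d).
Qed.

Lemma to_nat_Fp m : ((N.to_nat (N.modulo m q))%:R = (N.to_nat m)%:R :> 'F_qn)%R.
Proof. by apply/eqP; rewrite natr_eq_Fp // to_nat_mod modn_mod. Qed.

(* The subset sums of t/d for d in l, each equal to c or -c, fill a whole
   interval [o, o + W], because each c is at most one more than the length of
   the interval filled so far. *)
Lemma width_cover t l W : {subset map N.to_nat (unzip1 l) <= primes_below qn} ->
  width q t l = Some W ->
  exists o : 'F_qn, forall w, w <= N.to_nat W ->
    exists2 S, subseq S (map N.to_nat (unzip1 l))
      & (\sum_(x <- S) (N.to_nat t)%:R / x%:R = o + w%:R)%R.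
Proof.
elim: l W => [|[d c] l IH] W /=.
  move=> _ [<-]; exists 0%R => w; rewrite leqn0 => /eqP->.
  by exists [::]; rewrite // big_nil addr0.
move=> dsq; case: (width q t l) IH => // W' IH.
have [|o oP] := IH W' _ erefl.
  by move=> x xl; apply: dsq; rewrite inE xl orbT.
case: ifP => // /andP[/N.leb_spec0 cW congr] [<-].
have d0 : ((N.to_nat d)%:R != 0 :> 'F_qn)%R.
  by apply: natr_prime_below_neq0 => //; apply: dsq; rewrite mem_head.
have [tdc|tdc] : ((N.to_nat t)%:R / (N.to_nat d)%:R = (N.to_nat c)%:R :> 'F_qn \/
    (N.to_nat t)%:R / (N.to_nat d)%:R = - (N.to_nat c)%:R :> 'F_qn)%R.
  case/orP: congr => /N.eqb_spec eqt; [left|right]; apply: (mulIf d0); rewrite divfK //.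
    by rewrite -eqt to_nat_Fp N2Nat.inj_mul natrM mulrC.
  have := to_nat_Fp (d * c + t); rewrite eqt N2Nat.inj_add N2Nat.inj_mul natrD natrM.
  by move/esym/eqP; rewrite addrC addr_eq0 => /eqP ->; rewrite mulNr mulrC.
(* If [t/d = c], the interval grows upwards: [d] is used exactly for the values beyond the old
   range. *)
- exists o => w wW; have [w_le|w_gt] := leqP w (N.to_nat W').
    have [S Sl Sw] := oP w w_le; exists S => //.
    exact: subseq_trans Sl (subseq_cons _ _).
  have [|S Sl Sw] := oP (w - N.to_nat c); first by lia.
  exists (N.to_nat d :: S); first by rewrite /= eqxx.
  rewrite big_cons Sw tdc natrB; last by lia.
  by rewrite addrCA [(_ + (_ - _))%R]addrC subrK.
(* If [t/d = -c], the interval grows downwards, so its origin moves by [c] and [d] is used exactly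
   for the low values. *)
exists (o - (N.to_nat c)%:R)%R => w wW; have [w_le|w_gt] := leqP w (N.to_nat W').
  have [S Sl Sw] := oP w w_le.
  exists (N.to_nat d :: S); first by rewrite /= eqxx.
  by rewrite big_cons Sw tdc addrA [(- _ + o)%R]addrC.
have [|S Sl Sw] := oP (w - N.to_nat c); first by lia.
exists S; first exact: subseq_trans Sl (subseq_cons _ _).
by rewrite Sw natrB; [rewrite addrCA addrC -addrA addrC; rewrite addrAC -addrA addrC | lia].
Qed.

Lemma certifies_good t l : certifies tbl q t l -> good qn.
Proof.
case/and5P=> kp /N.ltb_spec0 t0 /N.ltb_spec0 tq; case wE : (width q t l) => [W|] //.
move=> /N.leb_spec0 qW /N.leb_spec0 cl.
have [uds dsq] := known_primesP kp; have [o oP] := width_cover dsq wE.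
apply: (@good_of_cover qn _ ((N.to_nat t)%:R)%R) uds dsq _ _ => //.
  by rewrite -(dvdn_pcharf (pchar_Fp q_pr)) gtnNdvd //; rewrite /qn; lia.
move=> r; have [|S Sl Sr] := oP (val (r - o)%R).
  have : val (r - o)%R < qn by rewrite -[X in _ < X](Fp_cast q_pr) ltn_ord.
  by rewrite /qn; lia.
exists S; split => //; last by rewrite Sr natr_Zp addrC subrK.
by apply: leq_trans (leq_sum_subseq _ Sl) _; rewrite -total_costE //; lia.
Qed.

Lemma residues_sound l r c x :
  {subset map N.to_nat (unzip1 l) <= primes_below qn} ->
  all (fun x => N.eqb (N.modulo (x.1 * x.2) q) 1) l -> x \in residues q l r c ->
  exists S, [/\ subseq S (map N.to_nat (unzip1 l)),
    N.to_nat c + \sum_(y <- S) costn y <= N.to_nat budget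
    & ((N.to_nat r)%:R + \sum_(y <- S) 1 / y%:R = (N.to_nat x)%:R :> 'F_qn)%R].
Proof.
elim: l r c => [|[d w] l IH] r c /=.
  move=> _ _; case: N.ltb_spec => //= cb; rewrite inE => /eqP->.
  by exists [::]; rewrite !big_nil addr0 to_nat_Fp addn0; split => //; clear -cb; lia.
move=> dsq /andP[/N.eqb_spec dw lw]; case: N.ltb_spec => //= cb; rewrite mem_cat.
have lq : {subset map N.to_nat (unzip1 l) <= primes_below qn}.
  by move=> y yl; apply: dsq; rewrite inE yl orbT.
have dq := dsq _ (mem_head _ _).
case/orP=> /(IH _ _ lq lw) [S [Sl cS Sx]]; last first.
  by exists S; split => //; apply: subseq_trans Sl (subseq_cons _ _).
have d0 : d <> N0 by move: dq; rewrite mem_primes_below => /andP[/prime_gt0]; case: (d).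
exists (N.to_nat d :: S); split; first by rewrite /= eqxx.
  by rewrite big_cons -costE // addnA; move: cS; rewrite N2Nat.inj_add.
rewrite -Sx big_cons addrA N2Nat.inj_add natrD; congr (_ + _ + _)%R.
have d0' : ((N.to_nat d)%:R != 0 :> 'F_qn)%R by apply: natr_prime_below_neq0.
have := to_nat_Fp (d * w); rewrite dw N2Nat.inj_mul natrM mulrC => dw1.
by apply: (mulIf d0'); rewrite divfK //; exact: dw1.
Qed.

Lemma residues_full_good l : residues_full tbl q l -> good qn.
Proof.
case/and3P=> kp lw /allP rs_full; have [uds dsq] := known_primesP kp.
apply: (@good_of_cover qn _ 1%R _ _ _ uds dsq _) => //.
move=> r; have rq : val r < qn by rewrite -[X in _ < X](Fp_cast q_pr) ltn_ord.
have /rs_full /(residues_sound dsq lw) [S [Sl cS Sr]] :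
    N.of_nat (val r) \in iotaN 0 qn.
  rewrite -(mem_map N2Nat.inj) map_iotaN mem_iota Nat2N.id add0n rq //.
by exists S; split => //; move: Sr; rewrite add0r Nat2N.id natr_Zp.
Qed.

End Soundness.

(* Extended Euclid without signs: for r0 = q and r1 = c it returns s with
   s * c = 1 or -1 modulo q. *)
Fixpoint euclid (fuel : nat) (r0 r1 s0 s1 : N) : N :=
  if fuel is f.+1 then
    if r1 is N0 then s0
    else let (k, r2) := N.div_eucl r0 r1 in euclid f r1 r2 s1 (s0 + k * s1)
  else s0.
Definition abs_inv (q c : N) : N := euclid 30 q c 0 1.

(* One of d and q - d is odd, hence more likely to be prime. *)
Definition odd_rep (q d : N) : N := if N.odd d then d else (q - d)%num.

(* Nothing is proved about the search: its result is checked by [certifies]. *)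
Section Search.
Variables (tbl : PositiveSet.t) (q t : N) (invs : seq N).

(** A candidate [d] with [t/d] equal to [c] or [-c]; inverses are known only up to sign, and [width]
    accepts both signs. *)
Definition quotient_rep (c : N) : N :=
  let s := if N.ltb c 17 then nth N0 invs (N.to_nat c) else abs_inv q c in
  odd_rep q (N.modulo (t * s) q).

Fixpoint find_step (fuel : nat) (c : N) (l : seq (N * N)) (bud : N) : option (N * N) :=
  if fuel is f.+1 then
    let d := quotient_rep c in
    if (if in_table tbl d then
          if N.leb (cost d) bud then ~~ has (fun x => N.eqb x.1 d) l else false
        else false)
    then Some (d, c) else find_step f (N.pred c) l bud
  else None.

(** A greedy search that tries the largest admissible step [W + 1] first and stops descending near
    [W / 2], so each success multiplies [W] by at least about 3/2. The empty list signals
    failure. *)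
Fixpoint complete (fuel : nat) (W : N) (l : seq (N * N)) (bud : N) : seq (N * N) :=
  if N.leb q (N.succ W) then l
  else if fuel is f.+1 then
    let tries := N.to_nat (N.min 30 (N.succ (N.div2 W))) in
    if find_step tries (N.succ W) l bud is Some (d, c)
    then complete f (W + c)%num ((d, c) :: l) (bud - cost d)%num
    else [::]
  else [::].

End Search.

Fixpoint find_cert (tbl : PositiveSet.t) (q : N) (invs ts : seq N) : option (N * seq (N * N)) :=
  if ts is t :: ts' then
    (* For odd [t] this [d] satisfies [2 d = t] or [-t] modulo [q]; with [t/t = 1] it starts the
       search at [W = 3]. *)
    let d := odd_rep q (N.div2 (q - t)) in
    let l := if in_table tbl d then
        complete tbl q t invs 20 3 [:: (d, 2%num); (t, 1%num)] (budget - cost t - cost d)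
      else [::] in
    if l is [::] then find_cert tbl q invs ts' else Some (t, l)
  else None.

Definition with_inverse (q d : N) : N * N :=
  let s := abs_inv q d in
  (d, if N.eqb (N.modulo (d * s) q) 1 then s else (q - s)%num).

(** [smaller] is in decreasing order in [check_all], so the primes with the cheapest reciprocals
    come first. Values below 31 are accepted outright, since [N >= 10] forces [q >= 31]. *)
Definition check (tbl : PositiveSet.t) (q : N) (smaller : seq N) : bool :=
  if N.ltb q 31 then true
  else if N.ltb q 79 then residues_full tbl q (map (with_inverse q) (take 9 smaller))
  else if find_cert tbl q (map (abs_inv q) (iotaN 0 17)) smaller is Some (t, l)
    then certifies tbl q t l else false.

Fixpoint check_all (tbl : PositiveSet.t) (smaller l : seq N) : bool :=
  if l is q :: l' then
    if check tbl q smaller then check_all tbl (q :: smaller) l' else false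
  else true.

Lemma check_good tbl q smaller : (forall d, in_table tbl d -> prime (N.to_nat d)) ->
  prime (N.to_nat q) -> 31 <= N.to_nat q ->
  6 * N.to_nat scale * N.to_nat q <= primorial 31 ->
  check tbl q smaller -> good (N.to_nat q).
Proof.
move=> tbl_prime q_pr q31 q_small; rewrite /check.
case: N.ltb_spec => [|_]; first by clear -q31; lia.
case: N.ltb_spec => _; first exact: residues_full_good.
by case: find_cert => // -[t l]; apply: certifies_good.
Qed.

Lemma check_all_good tbl smaller l q : (forall d, in_table tbl d -> prime (N.to_nat d)) ->
  prime (N.to_nat q) -> 31 <= N.to_nat q ->
  6 * N.to_nat scale * N.to_nat q <= primorial 31 ->
  check_all tbl smaller l -> q \in l -> good (N.to_nat q).
Proof.
move=> tbl_prime q_pr q31 q_small; elim: l smaller => //= q' l IH smaller.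
case: ifP => // chk rest; rewrite inE => /predU1P[eq_q|ql]; last exact: IH rest ql.
by apply: (@check_good tbl q smaller) => //; rewrite eq_q.
Qed.

Lemma check_all_true :
  let ps := primesN (129 ^ 2) in check_all (table ps) [::] [seq q <- ps | N.ltb q 8100].
Proof. by vm_compute. Qed.

Lemma primesN_prime m d : m <= 182 ^ 2 -> d \in primesN m -> prime (N.to_nat d).
Proof.
move=> m182 dm; have := map_f N.to_nat dm.
by rewrite map_primesN ?mem_primes_below => [/andP[]|].
Qed.

Lemma leq_129_182 : 129 ^ 2 <= 182 ^ 2.
Proof. by rewrite leq_exp2r. Qed.

Lemma good_below_8100 q : prime q -> 31 <= q -> q < N.to_nat 8100 -> good q.
Proof.
move=> q_pr q31 q8100; rewrite -(Nat2N.id q).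
apply: (check_all_good _ _ _ _ check_all_true); rewrite ?Nat2N.id //.
- by move=> d /in_tableP; apply: primesN_prime; exact: leq_129_182.
- have primes31 : primes_below 31 = [:: 2; 3; 5; 7; 11; 13; 17; 19; 23; 29] by vm_compute.
  rewrite /primorial primes31 !big_cons big_nil.
  by rewrite /scale; clear -q8100; lia.
rewrite mem_filter; apply/andP; split; first by apply/N.ltb_spec0; clear -q8100; lia.
rewrite -(mem_map N2Nat.inj) (map_primesN leq_129_182) mem_primes_below Nat2N.id q_pr /=.
by apply: leq_trans q8100 _; clear; lia.
Qed.

(** * Prime counts for intermediate q *)

Lemma size_primes_below_ge c q m : c <= q ->
  count (fun r => r < c) (primes_below m) <= size (primes_below q).
Proof.
move=> cq; rewrite -size_filter; apply: uniq_leq_size.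
  by rewrite filter_uniq ?primes_below_uniq.
move=> r; rewrite mem_filter !mem_primes_below => /and3P[rc -> _].
exact: leq_trans rc cq.
Qed.

Lemma good_range q x j (c : N) : 
  5 * (2 * x.+1 + j) <= count (fun n => N.ltb n c) (primesN (129 ^ 2)) ->
  x.+1 * 2 ^ j <= 3 ^ j -> 7 <= x -> 300 <= N.to_nat c ->
  prime q -> N.to_nat c <= q -> q < x.+1 ^ 2 -> good q.
Proof.
move=> cnt xj x7 c300 q_pr cq qx.
apply: (good_of_count q_pr (leq_trans c300 cq) x7 qx xj).
apply: leq_trans cnt (leq_trans _ (size_primes_below_ge (129 ^ 2) cq)).
rewrite -(map_primesN leq_129_182) count_map; apply: sub_count => n /N.ltb_spec0 /=.
by clear; lia.
Qed.

Lemma good_prime q : prime q -> 31 <= q -> good q.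
Proof.
move=> q_pr q31.
have [lt|ge] := ltnP q (N.to_nat 8100); first exact: good_below_8100.
(* On each range, [x + 1] is the square root of the right end, the primes are counted at the left
   end, and [j] is least with [(3/2)^j >= x + 1]. *)
have [lt|{}ge] := ltnP q (95 ^ 2).
  apply: (@good_range q 94 12 8100 _ _ _ _ q_pr ge lt).
  - by vm_compute.
  - by clear; lia.
  - by [].
  - by clear; lia.
have {}ge : N.to_nat 9025 <= q by clear -ge; lia.
have [lt|{}ge] := ltnP q (106 ^ 2).
  apply: (@good_range q 105 12 9025 _ _ _ _ q_pr ge lt).
  - by vm_compute.
  - by clear; lia.
  - by [].
  - by clear; lia.
have {}ge : N.to_nat 11236 <= q by clear -ge; lia.
have [lt|{}ge] := ltnP q (129 ^ 2).
  apply: (@good_range q 128 12 11236 _ _ _ _ q_pr ge lt).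
  - by vm_compute.
  - by clear; lia.
  - by [].
  - by clear; lia.
have {}ge : N.to_nat 16641 <= q by clear -ge; lia.
have [lt|{}ge] := ltnP q (182 ^ 2).
  apply: (@good_range q 181 13 16641 _ _ _ _ q_pr ge lt).
  - by vm_compute.
  - by clear; lia.
  - by [].
  - by clear; lia.
exact: good_large.
Qed.

#[local] Arguments p : simpl never.

(** * From primes below q to the sets D1, D2 *)

Lemma next_primeP m : [/\ m < next_prime m, prime (next_prime m)
  & forall r, m < r -> prime r -> next_prime m <= r].
Proof.
rewrite /next_prime; case: ex_minnP => r /andP[mr r_pr] r_min; split => // s ms s_pr.
by apply: r_min; rewrite ms.
Qed.

Lemma p_prime n : 0 < n -> prime (p n).
Proof. by case: n => // n _; case: (next_primeP (p n)). Qed.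

Lemma p_lt i j : i < j -> p i < p j.
Proof.
elim: j => // j IH; rewrite ltnS leq_eqVlt.
have [lt _ _] : [/\ p j < p j.+1, true & true] by case: (next_primeP (p j)).
by case/predU1P=> [->|/IH ij] //; apply: ltn_trans lt.
Qed.

Lemma p_inj : injective p.
Proof.
move=> i j eq_p; case: (ltngtP i j) => // /p_lt; rewrite eq_p ltnn //.
Qed.

Lemma primes_below_p N : primes_below (p N.+1) = [seq p i | i <- index_iota 1 N.+1].
Proof.
have next m : primes_below (next_prime m) = primes_below m.+1.
  have [mq _ q_min] := next_primeP m; rewrite (primes_below_cat mq).
  rewrite (@eq_in_filter _ _ pred0) ?filter_pred0 ?cats0 // => r.
  rewrite mem_iota subnKC // => /andP[mr rq]; apply/negbTE/negP => r_pr.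
  by have := q_min r mr r_pr; rewrite leqNgt rq.
elim: N => [|N IH]; first by rewrite [p 1]/(next_prime 1) next.
rewrite [p N.+2]/(next_prime (p N.+1)) next (primes_below_cat (leqnSn (p N.+1))) IH.
have -> : [seq r <- iota (p N.+1) ((p N.+1).+1 - p N.+1) | prime r] = [:: p N.+1].
  by rewrite subSnn /filter /iota p_prime.
by rewrite /index_iota !subn1 -[N.+2.-1]addn1 iotaD map_cat add1n.
Qed.

Lemma size_primes_below_p N : size (primes_below (p N.+1)) = N.
Proof. by rewrite primes_below_p size_map size_iota subn1. Qed.

Lemma p_ge31 N : 10 <= N -> 31 <= p N.+1.
Proof.
move=> N10; rewrite ltnNge; apply/negP => q30.
have q29 : p N.+1 <= 29.
  by move: q30 (p_prime (ltn0Sn N)); rewrite leq_eqVlt => /predU1P[->|].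
have := primes_below_cat q29 => /(congr1 size); rewrite size_cat size_primes_below_p.
by have -> : size (primes_below 29) = 9 by []; lia.
Qed.

Lemma P_primorial N : P N = primorial (p N.+1).
Proof. by rewrite /primorial primes_below_p big_map. Qed.

Lemma P_gt0 N : 0 < P N.
Proof. by rewrite /P big_nat prodn_cond_gt0 // => i /andP[i1 _]; rewrite prime_gt0 ?p_prime. Qed.

Lemma PS N : P N.+1 = P N * p N.+1.
Proof. by rewrite /P big_nat_recr. Qed.

Lemma dvdn_p_P N i : 0 < i <= N -> p i %| P N.
Proof.
case/andP=> i0 iN; rewrite P_primorial; apply: dvdn_primorial.
by rewrite mem_primes_below p_prime //= p_lt.
Qed.

Lemma dvdn_pp_P N i j : 0 < i -> i < j -> j <= N -> p i * p j %| P N.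
Proof.
move=> i0 ij jN; rewrite Gauss_dvd ?dvdn_p_P ?i0 ?(leq_trans (ltnW ij)) //.
  by rewrite (leq_ltn_trans _ ij).
rewrite prime_coprime ?dvdn_prime2 ?p_prime ?(leq_ltn_trans _ ij) //.
by apply/eqP => /p_inj eq_ij; rewrite eq_ij ltnn in ij.
Qed.

Lemma divn_inj M x y : 0 < M -> x %| M -> y %| M -> M %/ x = M %/ y -> x = y.
Proof.
move=> M0 /dvdnP[u Mu] /dvdnP[v Mv]; have x0 : 0 < x by case: x Mu M0 => //; lia.
have y0 : 0 < y by case: y Mv M0 => //; lia.
rewrite {1}Mu Mv !mulnK // => uv; apply/eqP; rewrite -(@eqn_pmul2l u).
  by rewrite -Mu {1}Mv uv.
by case: (u) Mu M0 => // ->.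
Qed.

Lemma big_fset_seq (s : seq nat) : uniq s -> \sum_(x <- [fset x in s]%fset) x = \sum_(x <- s) x.
Proof.
move=> us; apply: perm_big; apply: uniq_perm => // x.
by rewrite inE.
Qed.

Lemma cofactor_map_uniq q S : uniq S -> {subset S <= primes_below q} ->
  uniq [seq primorial q %/ x | x <- S].
Proof.
move=> uS Sq; rewrite map_inj_in_uniq // => x y /Sq xq /Sq yq; apply: divn_inj.
- by apply: leq_trans (primorial_ge q); rewrite expn_gt0.
- exact: dvdn_primorial.
- exact: dvdn_primorial.
Qed.

Lemma D1E N : D1 N = [fset x in [seq primorial (p N.+1) %/ x | x <- primes_below (p N.+1)]]%fset.
Proof. by rewrite /D1 primes_below_p -map_comp P_primorial. Qed.

Lemma sigma1E N : sigma1 N = cofactor_sum (p N.+1) (primes_below (p N.+1)).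
Proof.
rewrite /sigma1 D1E big_fset_seq ?cofactor_map_uniq ?primes_below_uniq //.
by rewrite big_map.
Qed.

(** Unique factorization ensures that distinct pairs give distinct elements of [D2 N], so that
    [sigma2] is the full double sum. *)
Lemma pp_inj i j k l : 0 < i -> i < j -> 0 < k -> k < l -> p i * p j = p k * p l ->
  i = k /\ j = l.
Proof.
move=> i0 ij k0 kl eq_pp.
have key m : 0 < m -> p m %| p k * p l -> m = k \/ m = l.
  move=> m0; rewrite Euclid_dvdM ?dvdn_prime2 ?p_prime // ?(leq_ltn_trans _ kl) //.
  by case/orP => /eqP/p_inj; [left|right].
have j0 : 0 < j by exact: leq_ltn_trans ij.
have := key i i0; rewrite -eq_pp dvdn_mulr // => /(_ isT) ikl.
have := key j j0; rewrite -eq_pp dvdn_mull // => /(_ isT) jkl.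
by clear -ij kl ikl jkl; split; lia.
Qed.

Lemma sigma2E N : sigma2 N =
  \sum_(1 <= i < N.+1) \sum_(i.+1 <= j < N.+1) P N %/ (p i * p j).
Proof.
rewrite /sigma2 big_fset_seq; first by rewrite big_allpairs_dep.
apply: allpairs_uniq_dep => [|i _|]; rewrite ?iota_uniq //.
move=> _ _ /allpairsPdep[i [j [iN jN ->]]] /allpairsPdep[k [l [kN lN ->]]] /=.
move: iN jN kN lN; rewrite !mem_index_iota => /andP[i0 iN] /andP[ij jN] /andP[k0 kN] /andP[kl lN].
move/(divn_inj (P_gt0 N)); rewrite !dvdn_pp_P // => /(_ isT isT).
by case/pp_inj => // -> ->.
Qed.

(** Pairs containing the new prime contribute [P N %/ p i]; for the others the new prime multiplies
    the old term. *)
Lemma sigma2S N : sigma2 N.+1 = p N.+1 * sigma2 N + sigma1 N.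
Proof.
have -> : sigma1 N = \sum_(1 <= i < N.+1) P N %/ p i.
  by rewrite sigma1E /cofactor_sum primes_below_p big_map P_primorial.
rewrite !sigma2E big_nat_recr //= [X in _ + X]big_geq // addn0 big_distrr /= -big_split /=.
rewrite big_nat [RHS]big_nat; apply: eq_bigr => i /andP[i0 iN].
have q0 : 0 < p N.+1 by rewrite prime_gt0 ?p_prime.
rewrite big_nat_recr //=; congr (_ + _).
  rewrite big_distrr /= big_nat [RHS]big_nat; apply: eq_bigr => j /andP[ij jN].
  by rewrite PS mulnC muln_divA // dvdn_pp_P.
by rewrite PS divnMr.
Qed.

Local Open Scope ring_scope.

Lemma subset_sum_good N (r : nat) : (10 <= N)%N ->
  exists S : {fset nat}, [/\ S \in fpowerset (D1 N),
    (\sum_(x <- S) x = r %[mod p N.+1])%N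
    & (6 * (\sum_(x <- S) x + p N.+1) <= sigma1 N)%N].
Proof.
move=> N10; have [S [uS Sq Sr Sle]] := good_prime (p_prime (ltn0Sn N)) (p_ge31 N10) r.
have sumS : (\sum_(x <- [fset x in [seq primorial (p N.+1) %/ x | x <- S]]%fset) x)%N
    = cofactor_sum (p N.+1) S.
  by rewrite big_fset_seq ?cofactor_map_uniq // big_map.
exists [fset x in [seq (primorial (p N.+1) %/ x)%N | x <- S]]%fset; split.
- rewrite fpowersetE D1E; apply/fsubsetP => x; rewrite !inE => /mapP[y yS ->].
  by apply/map_f/Sq.
- by rewrite sumS.
by rewrite sumS sigma1E.
Qed.

(** * Bounds for Y0, beta and beta' *)

Section ExtendedBigops.
Variables (I : eqType) (R : realDomainType).
Implicit Types (s : seq I) (F : I -> \bar R) (Q : pred I).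

Lemma bigmine_le s Q F i : i \in s -> Q i ->
  (\big[mine/+oo%E]_(j <- s | Q j) F j <= F i)%E.
Proof.
elim: s => // j s IH; rewrite inE big_cons => /predU1P[<- ->|/IH h Qi].
  by rewrite ge_min lexx.
by case: ifP => _; rewrite ?ge_min ?h ?orbT.
Qed.

Lemma le_bigmine s Q F x : (forall i, Q i -> (x <= F i)%E) ->
  (x <= \big[mine/+oo%E]_(j <- s | Q j) F j)%E.
Proof.
move=> xF; elim/big_ind: _ => //; first exact: leey.
by move=> u v xu xv; rewrite le_min xu.
Qed.

Lemma bigmaxe_le s F x : (forall i, (F i <= x)%E) ->
  (\big[maxe/-oo%E]_(j <- s) F j <= x)%E.
Proof.
move=> xF; elim/big_ind: _ => //; first exact: leNye.
by move=> u v xu xv; rewrite ge_max xu.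
Qed.

Lemma le_bigmaxe s F i : i \in s -> (F i <= \big[maxe/-oo%E]_(j <- s) F j)%E.
Proof.
elim: s => // j s IH; rewrite inE big_cons => /predU1P[<-|/IH h].
  by rewrite le_max lexx.
by rewrite le_max h orbT.
Qed.

End ExtendedBigops.

Lemma Y0_le N : (10 <= N)%N ->
  (Y0 N <= (1 / 6 * (sigma1 N)%:R - (p N.+1)%:R)%:E)%E.
Proof.
move=> N10; apply: bigmaxe_le => r; have [S [SD Sr Sle]] := subset_sum_good r N10.
apply: le_trans (bigmine_le _ SD _) _.
  (* ['Z_n] is the ring of residues modulo [n] only when [n > 1]. *)
  have q1 : (1 < p N.+1)%N by rewrite prime_gt1 ?p_prime.
  rewrite -[r]natr_Zp; apply/eqP/val_inj; rewrite /= !val_Zp_nat //.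
rewrite lee_fin; have : (6 * (\sum_(x <- S) x + p N.+1))%:R <= (sigma1 N)%:R :> rat.
  by rewrite ler_nat.
by rewrite natrM natrD; lra.
Qed.

(** Excludes the value [-oo] in the finiteness claim; an empty inner minimum is [+oo] and causes no
    harm here. *)
Lemma Y0_ge0 N : (0 <= Y0 N)%E.
Proof.
apply: le_trans (le_bigmaxe _ (mem_index_enum (0 : 'Z_(p N.+1)))).
by apply: le_bigmine => S _; rewrite lee_fin.
Qed.

(** Rounding up costs less than 1 in [a N], hence at most [q] in [beta N]; by [sigma2S] the terms in
    [sigma2 N] cancel. The argument for [beta'] is the same with floors, where [1 - 5/6 = 1/6]. *)
Lemma le_beta N : 1 / 6 * (sigma1 N)%:R - (p N.+1)%:R <= (beta N)%:~R :> rat.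
Proof.
have a1 : 1 / 6 * (sigma2 N.+1)%:R <= (a N.+1)%:~R :> rat.
  by case/andP: (ceil_itv (1 / 6 * (sigma2 N.+1)%:R : rat)).
have a0 : (a N - 1)%:~R < 1 / 6 * (sigma2 N)%:R :> rat.
  by case/andP: (ceil_itv (1 / 6 * (sigma2 N)%:R : rat)).
have -> : (beta N)%:~R = (a N.+1)%:~R - (p N.+1)%:R * (a N)%:~R :> rat.
  by rewrite /beta intrB intrM.
move: a1 a0 (ler0n rat (p N.+1)); rewrite sigma2S natrD natrM intrB.
move: (a N)%:~R (a N.+1)%:~R (sigma1 N)%:R (sigma2 N)%:R (p N.+1)%:R; clear.
by move=> a0 a1 s1 s2 q; nra.
Qed.

Lemma le_beta' N : 1 / 6 * (sigma1 N)%:R - (p N.+1)%:R <= (beta' N)%:~R :> rat.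
Proof.
have b1 : (b N.+1)%:~R <= 5 / 6 * (sigma2 N.+1)%:R :> rat.
  by case/andP: (floor_itv (5 / 6 * (sigma2 N.+1)%:R : rat)).
have b0 : 5 / 6 * (sigma2 N)%:R < (b N + 1)%:~R :> rat.
  by case/andP: (floor_itv (5 / 6 * (sigma2 N)%:R : rat)).
have -> : (beta' N)%:~R =
    (sigma1 N)%:R - (b N.+1)%:~R + (p N.+1)%:R * (b N)%:~R :> rat.
  by rewrite /beta' intrD intrB intrM.
move: b1 b0 (ler0n rat (p N.+1)); rewrite sigma2S natrD natrM intrD.
move: (b N)%:~R (b N.+1)%:~R (sigma1 N)%:R (sigma2 N)%:R (p N.+1)%:R; clear.
by move=> b0 b1 s1 s2 q; nra.
Qed.

Theorem theorem5p4 :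
  (forall N : nat, (10 <= N)%N ->
     Y0 N \is a fin_num /\
     (Y0 N <= ((Num.min (beta N) (beta' N))%:~R)%:E)%E) /\
  (forall N : nat, (300 <= N)%N ->
     (Y0 N <= (1 / 6 * (sigma1 N)%:R - (p N.+1)%:R)%:E)%E).
Proof.
split=> N N10; last by apply: Y0_le; apply: leq_trans N10.
have YN := Y0_le N10; split.
  by rewrite fin_real // (lt_le_trans _ (Y0_ge0 N)) ?ltNy0 // (le_lt_trans YN) ?ltry.
apply: le_trans YN _; rewrite lee_fin.
by case: (leP (beta N) (beta' N)) => _; [exact: le_beta | exact: le_beta'].
Qed.
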